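(* Let $a>0$, and let the integer $m$ be defined by $m<a\le m+1$. If $\Lambda=\{\Lambda_n\}_{n\ge0}$ is a sequence of real numbers, then the following statements are equivalent: (i) $(1-\nabla)^a\Lambda\equiv0$ (i.e., all the terms of the sequence $(1-\nabla)^a\Lambda$ are $0$); (ii) $(1-\nabla)^{m+1}\Lambda\equiv0$; (iii) there exists a polynomial $p$ of degree at most $m$ such that $\Lambda_n=p(n)$ for every $n\ge0$.
   Context: For $a\in\mathbb{R}$, $k^{-a}(j)$ denotes the $j$-th Taylor coefficient at the origin of $(1-t)^a$. For a real sequence $\Lambda$, $(1-\nabla)^a\Lambda$ is the sequence with $n$-th term $(1-\nabla)^a\Lambda_n:=\sum_{j=0}^\infty k^{-a}(j)\Lambda_{j+n}$, defined when this series converges for every $n\ge0$. The condition $(1-\nabla)^a\Lambda\equiv0$ includes the convergence of these series. *)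

(* Defs.v *)
From HB Require Import structures.
From mathcomp Require Import all_boot all_order all_algebra.
From mathcomp Require Import all_classical all_reals all_analysis.

Set Implicit Arguments.
Unset Strict Implicit.
Unset Printing Implicit Defensive.

Import Order.TTheory GRing.Theory Num.Theory.
Import numFieldNormedType.Exports.
Local Open Scope classical_set_scope.
Local Open Scope ring_scope.

Definition taylor_coef (R : realType) (f : R -> R) (j : nat) : R :=
  f^`(j)%classic 0 / j`!%:R.

(* [kcoef b j] is k^b(j), so that k^{-a}(j), written [kcoef (- a) j], is the
   j-th Taylor coefficient at 0 of (1 - t)^a. Only t near 0 matters, where
   1 - t > 0 and [powR] is the genuine real power. *)
Definition kcoef (R : realType) (b : R) (j : nat) : R :=
  taylor_coef (fun t : R => (1 - t) `^ (- b)) j.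

Definition nabla_term (R : realType) (a : R) (L : R^nat) (n : nat) : R^nat :=
  fun j => kcoef (- a) j * L (j + n)%N.

Definition nabla_pow_defined (R : realType) (a : R) (L : R^nat) : Prop :=
  forall n : nat, cvgn (series (nabla_term a L n)).

(* (1 - nabla)^a L; meaningful only under [nabla_pow_defined a L], since
   [limn] is total. *)
Definition nabla_pow (R : realType) (a : R) (L : R^nat) : R^nat :=
  fun n => limn (series (nabla_term a L n)).

Definition nabla_pow_vanishes (R : realType) (a : R) (L : R^nat) : Prop :=
  nabla_pow_defined a L /\ (forall n : nat, nabla_pow a L n = 0).

(* Main.v *)
Require Import Defs.
From HB Require Import structures.
From mathcomp Require Import all_boot all_order all_algebra.
From mathcomp Require Import all_classical all_reals all_analysis.
From mathcomp Require Import ring lra zify.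

Set Implicit Arguments.
Unset Strict Implicit.
Unset Printing Implicit Defensive.

Import Order.TTheory GRing.Theory Num.Theory.
Import numFieldNormedType.Exports.
Local Open Scope classical_set_scope.
Local Open Scope ring_scope.

(* Write c_l for the l-th Taylor coefficient of (1 - t)^a.

   (iii) => (i): it suffices to treat the falling factorials l^_k, k < a, and
   their weighted sums telescope,
     \sum_(l < N) c_l l^_k = c_N N^_(k+1) / (k - a) --> 0.

   (i) => (ii), for m < a < m + 1: multiplying (1 - t)^a by the denominator of
   a suitably normalized Pade approximant of type (m + 1, M) turns c_l into
     c_l K_M \prod_(q < M) (l - m - 2 - q) / (l - a - 1 - q),
     K_M = \prod_(q < M) (a + 1 + q) / (m + 2 + q).
   As the multiplier is a polynomial in t, this gives again a series against
   Lambda with sum 0. Its terms with l <= m + 1 tend to those of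
   (1 - nabla)^(m + 1) as M grows, the terms with m + 2 <= l < m + 2 + M vanish,
   and the factor of c_l Lambda_l in the remaining ones is nondecreasing in l
   with values in [0, K_M], so by Abel summation their sum is O(K_M). Finally
   K_M --> 0 because a < m + 1. *)

(** * Taylor coefficients of [(1 - t)^a] *)

(** Product form of [(-1)^l] times the generalized binomial coefficient [a] over [l]. *)
Definition binom_coef (R : realType) (a : R) (l : nat) : R :=
  \prod_(i < l) ((i%:R - a) / i.+1%:R).

Lemma binom_coef0 (R : realType) (a : R) : binom_coef a 0 = 1.
Proof. by rewrite /binom_coef big_ord0. Qed.

Lemma binom_coefS (R : realType) (a : R) (l : nat) :
  binom_coef a l.+1 = binom_coef a l * ((l%:R - a) / l.+1%:R).
Proof. by rewrite /binom_coef big_ord_recr. Qed.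

Lemma binom_coef_neq0 (R : realType) (a : R) (l : nat) :
  (forall i, (i < l)%N -> i%:R != a) -> binom_coef a l != 0.
Proof.
move=> ha; apply/prodf_neq0 => i _.
by rewrite mulf_neq0 ?invr_eq0 ?pnatr_eq0// subr_eq0 ha.
Qed.

Lemma binom_coef_nat_eq0 (R : realType) (n l : nat) :
  (n < l)%N -> binom_coef (n%:R : R) l = 0.
Proof.
move=> nl; apply/eqP/prodf_eq0; exists (Ordinal nl) => //.
by rewrite subrr mul0r.
Qed.

Lemma derive1n_powR_1sub (R : realType) (a : R) (n : nat) (t : R) : t < 1 ->
  ((fun t : R => (1 - t) `^ a)^`(n))%classic t =
  (\prod_(i < n) (i%:R - a)) * (1 - t) `^ (a - n%:R).
Proof.
elim: n t => [|n IH] t t1; first by rewrite derive1n0 big_ord0 mul1r subr0.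
rewrite derive1nS derive1E.
(* The induction hypothesis holds only to the left of 1, so it is substituted as an equality near
   [t]. *)
rewrite (@near_eq_derive _ _ _ _
  (fun t : R => (\prod_(i < n) (i%:R - a)) * (1 - t) `^ (a - n%:R))).
  have t1' : 0 < 1 - t by rewrite subr_gt0.
  have d1 : is_derive t 1 (fun t : R => 1 - t) (0 - 1).
    by apply: is_deriveB.
  have d2 := is_derive1_powR (a - n%:R) t1'.
  have d3 : is_derive t 1 (fun t : R => (1 - t) `^ (a - n%:R))
    ((a - n%:R) * (1 - t) `^ (a - n%:R - 1) * (0 - 1)).
    exact: (@is_derive1_comp _ (fun x => x `^ (a - n%:R)) (fun t : R => 1 - t)
      t _ _ d2 d1).
  have -> := @derive_val _ _ _ _ _ _ _
    (is_deriveZ (\prod_(i < n) (i%:R - a)) d3).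
  rewrite big_ord_recr /= -[n.+1]addn1 natrD opprD addrA /GRing.scale /=.
  ring.
near=> u; apply: IH; near: u.
exact: lt_nbhsl.
Unshelve. all: by end_near. Qed.

Lemma kcoefN (R : realType) (a : R) (j : nat) : kcoef (- a) j = binom_coef a j.
Proof.
rewrite /kcoef /taylor_coef opprK derive1n_powR_1sub ?ltr01//.
rewrite subr0 powR1 mulr1; elim: j => [|j IH].
  by rewrite big_ord0 binom_coef0 fact0 divr1.
rewrite big_ord_recr /= factS natrM invfM binom_coefS -IH.
by rewrite [X in _ * X = _]mulrC mulrACA.
Qed.

(** * Limits of sequences *)

(* [|u n| <= |u 0| exp (- s \sum_(i < n) 1 / (i + k + 1))], and the harmonic
   series diverges. *)
Lemma cvg0_of_ratio (R : realType) (s : R) (k : nat) (u : R^nat) :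
  0 < s -> s <= k.+1%:R ->
  (forall n, u n.+1 = (1 - s / (n + k).+1%:R) * u n) ->
  u @ \oo --> (0 : R).
Proof.
move=> s0 sk uS.
pose h : R^nat := fun n => series harmonic (n + k)%N - series harmonic k.
have ub n : `|u n| <= `|u 0%N| * expR (- (s * h n)).
  elim: n => [|n IH]; first by rewrite /h add0n subrr mulr0 oppr0 expR0 mulr1.
  have -> : h n.+1 = h n + (n + k).+1%:R^-1.
    by rewrite /h addSn /series /= big_nat_recr//= addrAC.
  rewrite uS normrM mulrDr opprD expRD.
  have f0 : 0 <= 1 - s / (n + k).+1%:R.
    rewrite subr_ge0 ler_pdivrMr ?ltr0n// mul1r (le_trans sk)// ler_nat.
    by rewrite ltnS leq_addl.
  rewrite ger0_norm// mulrC mulrA ler_pM//.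
  by rewrite (le_trans _ (expR_ge1Dx _)).
have hoo : h n @[n --> \oo] --> +oo.
  have h1 : series (@harmonic R) @ \oo --> +oo.
    apply: nondecreasing_dvgn_lt (@dvg_harmonic R).
    by apply/nondecreasing_series => i _ _; exact: harmonic_ge0.
  move: h1; rewrite -(cvg_shiftn k) => h1.
  exact: (cvg_comp _ _ h1 (cvg_addrr (- series harmonic k))).
apply/norm_cvg0P.
apply: (squeeze_cvgr (f := fun=> 0)
  (h := fun n => `|u 0%N| * expR (- (s * h n)))).
- by near=> n; rewrite normr_ge0 ub.
- exact: cvg_cst.
- rewrite -[X in _ --> X](mulr0 `|u 0%N|); apply: cvgM; first exact: cvg_cst.
  exact: (cvg_comp _ _ hoo (cvg_comp _ _ (gt0_cvgMry s0 cvg_id) (@cvgr_expR R))).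
Unshelve. all: by end_near. Qed.

Lemma cvg_sum_ord (R : realType) (n : nat) (u : nat -> R^nat) (l : R^nat) :
  (forall i, (i < n)%N -> u i @ \oo --> l i) ->
  \sum_(i < n) u i N @[N --> \oo] --> \sum_(i < n) l i.
Proof.
elim: n => [|n IH] ul.
  by rewrite big_ord0; under eq_fun do rewrite big_ord0; exact: cvg_cst.
rewrite big_ord_recr; under eq_fun do rewrite big_ord_recr.
by apply: cvgD; [apply: IH => i ni; apply: ul; exact: ltnW | exact: ul].
Qed.

Lemma cvg_lincomb0 (R : realType) (n : nat) (w : R^nat) (u : nat -> R^nat) :
  (forall i, (i < n)%N -> u i @ \oo --> (0 : R)) ->
  \sum_(i < n) w i * u i N @[N --> \oo] --> (0 : R).
Proof.
move=> u0; have {2}-> : (0 : R) = \sum_(i < n) w i * 0.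
  by rewrite big1// => i _; rewrite mulr0.
apply: (@cvg_sum_ord _ n (fun i N => w i * u i N) (fun i => w i * 0)) => i ni.
by apply: cvgM; [exact: cvg_cst | exact: u0].
Qed.

(** * Interpolation at natural numbers and polynomial bases *)

Lemma triangular_system (F : fieldType) (n : nat) (e : nat -> nat -> F)
    (y : nat -> F) :
  (forall i k, (k < i)%N -> e i k = 0) ->
  (forall i, (i < n)%N -> e i i != 0) ->
  exists w : nat -> F, forall k, (k < n)%N -> \sum_(i < n) w i * e i k = y k.
Proof.
move=> e0; elim: n => [|n IH] en0; first by exists (fun=> 0).
have [i ni|w wE] := IH; first by apply: en0; apply: ltnW.
(* [v] is forced by equation [n]; the earlier equations are undisturbed because [e n k = 0] for
   [k < n]. *)
pose v := (y n - \sum_(i < n) w i * e i n) / e n n.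
have widen k : \sum_(i < n) (if (i < n)%N then w i else v) * e i k =
    \sum_(i < n) w i * e i k.
  by apply: eq_bigr => i _; rewrite ltn_ord.
exists (fun i => if (i < n)%N then w i else v) => k.
rewrite ltnS leq_eqVlt big_ord_recr /= ltnn widen => /orP[/eqP->|kn].
  by rewrite divfK ?en0// addrC subrK.
by rewrite wE// e0// mulr0 addr0.
Qed.

Lemma poly_eq_on_nat (F : numFieldType) (n : nat) (p q : {poly F}) :
  (size p <= n)%N -> (size q <= n)%N ->
  (forall k, (k < n)%N -> p.[k%:R] = q.[k%:R]) -> p = q.
Proof.
move=> sp sq pq; apply/eqP; rewrite -subr_eq0; apply/eqP.
apply: (@roots_geq_poly_eq0 _ _ [seq k%:R | k <- iota 0 n]).
- apply/allP => x /mapP[k]; rewrite mem_iota add0n => /andP[_ kn] ->.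
  by rewrite /root hornerD hornerN pq// subrr.
- by rewrite map_inj_uniq ?iota_uniq// => i j /eqP; rewrite eqr_nat => /eqP.
- by rewrite size_map size_iota (leq_trans (size_polyD _ _))// size_polyN geq_max sp.
Qed.

(** A polynomial of size at most [n] is determined by its values at [0, ..., n - 1], and the values
    of the [e i] there form an invertible triangular matrix. *)
Lemma triangular_poly_basis (F : numFieldType) (n : nat) (e : nat -> {poly F})
    (p : {poly F}) :
  (forall i, (i < n)%N -> (size (e i) <= n)%N) ->
  (forall i k, (k < i)%N -> (e i).[k%:R] = 0) ->
  (forall i, (i < n)%N -> (e i).[i%:R] != 0) ->
  (size p <= n)%N ->
  exists w : nat -> F, p = \sum_(i < n) w i *: e i.
Proof.
move=> se e0 en0 sp.
have [w wE] := triangular_system (fun k => p.[k%:R]) e0 en0.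
exists w; apply: (poly_eq_on_nat sp).
  apply: (leq_trans (size_sum _ _ _)); apply/bigmax_leqP => i _.
  by rewrite (leq_trans (size_scale_leq _ _))// se.
move=> k kn; rewrite -wE// horner_sum.
by apply: eq_bigr => i _; rewrite hornerZ.
Qed.

Definition ffact_poly (R : realType) (k : nat) : {poly R} :=
  \prod_(q < k) ('X - q%:R%:P).

Lemma size_ffact_poly (R : realType) (k : nat) : size (ffact_poly R k) = k.+1.
Proof. by rewrite size_prod_XsubC /index_enum -enumT size_enum_ord. Qed.

Lemma ffact_polyS (R : realType) (k : nat) (x : R) :
  (ffact_poly R k.+1).[x] = (ffact_poly R k).[x] * (x - k%:R).
Proof. by rewrite /ffact_poly big_ord_recr hornerM hornerXsubC. Qed.

Lemma ffact_polySS (R : realType) (k : nat) (x : R) :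
  (ffact_poly R k.+1).[x + 1] = (x + 1) * (ffact_poly R k).[x].
Proof.
elim: k => [|k IH].
  by rewrite ffact_polyS /ffact_poly !big_ord0 !hornerC subr0 mulrC.
by rewrite ffact_polyS IH ffact_polyS -[k.+1]addn1 natrD; ring.
Qed.

Lemma ffact_poly_nat_eq0 (R : realType) (i k : nat) :
  (k < i)%N -> (ffact_poly R i).[k%:R] = 0.
Proof.
move=> ki; rewrite horner_prod; apply/eqP/prodf_eq0; exists (Ordinal ki) => //.
by rewrite hornerXsubC subrr.
Qed.

Lemma ffact_poly_nat_neq0 (R : realType) (i : nat) :
  (ffact_poly R i).[i%:R] != 0.
Proof.
rewrite horner_prod; apply/prodf_neq0 => k _.
by rewrite hornerXsubC subr_eq0 eqr_nat gtn_eqF.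
Qed.

Lemma newton_basis (R : realType) (n : nat) (p : {poly R}) : (size p <= n)%N ->
  exists w : nat -> R, p = \sum_(i < n) w i *: ffact_poly R i.
Proof.
apply: triangular_poly_basis => [i ?|i k|i _]; first by rewrite size_ffact_poly.
- exact: ffact_poly_nat_eq0.
- exact: ffact_poly_nat_neq0.
Qed.

Lemma poly_interpolation_nat (R : realType) (n : nat) (y : R^nat) :
  exists2 p : {poly R}, (size p <= n)%N &
    forall k, (k < n)%N -> p.[k%:R] = y k.
Proof.
have [w wE] := triangular_system y (@ffact_poly_nat_eq0 R)
  (fun i (_ : (i < n)%N) => ffact_poly_nat_neq0 R i).
exists (\sum_(i < n) w i *: ffact_poly R i) => [|k kn].
  apply: (leq_trans (size_sum _ _ _)); apply/bigmax_leqP => i _.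
  by rewrite (leq_trans (size_scale_leq _ _))// size_ffact_poly.
by rewrite horner_sum -wE//; apply: eq_bigr => i _; rewrite hornerZ.
Qed.

(** * Summing the coefficients against polynomials *)

(** With [c = binom_coef a], [c_(N+1) (N+1)^_(k+1) = c_N N^_k (N - a)] and
    [c_N N^_(k+1) = c_N N^_k (N - k)]; these differ by [(k - a) c_N N^_k]. *)
Lemma sum_binom_coef_ffact (R : realType) (a : R) (k N : nat) : k%:R != a ->
  \sum_(0 <= l < N) binom_coef a l * (ffact_poly R k).[l%:R] =
  binom_coef a N * (ffact_poly R k.+1).[N%:R] / (k%:R - a).
Proof.
rewrite -subr_eq0 => ka; elim: N => [|N IH].
  by rewrite big_geq// ffact_poly_nat_eq0// mulr0 mul0r.
rewrite big_nat_recr//= IH ffact_polyS binom_coefS -[N.+1]addn1 natrD.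
rewrite ffact_polySS; field.
by rewrite ka natr1 pnatr_eq0.
Qed.

Lemma cvg_binom_coef_ffact (R : realType) (a : R) (k : nat) : k%:R < a ->
  binom_coef a N * (ffact_poly R k.+1).[N%:R] @[N --> \oo] --> (0 : R).
Proof.
move=> ka; pose m := Num.truncn a.
have am : a <= m.+1%:R.
  exact/ltW/truncnS_gt.
(* The ratio of consecutive terms is [1 - (a - k) / (N - k)]. The shift makes [N - k = n + m + 1],
   and [a <= m + 1] keeps the ratio nonnegative. *)
rewrite -(cvg_shiftn (m + k.+1)) /=.
apply: (@cvg0_of_ratio _ (a - k%:R) m); first by rewrite subr_gt0.
  by rewrite (le_trans _ am)// gerBl.
move=> n; rewrite addSn binom_coefS -[X in _.[X]]natr1 ffact_polySS ffact_polyS.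
set x := ffact_poly R k; rewrite -[(n + m).+1%:R]natr1 -[(_ + _).+1%:R]natr1.
rewrite !natrD -natr1.
field.
by rewrite !natr1 -!natrD !natr1 !pnatr_eq0.
Qed.

Lemma series_binom_coef_poly (R : realType) (a : R) (m : nat) (p : {poly R}) :
  m%:R < a -> (size p <= m.+1)%N ->
  series (fun j => binom_coef a j * p.[j%:R]) @ \oo --> (0 : R).
Proof.
move=> ma /newton_basis[w ->].
have ia i : (i < m.+1)%N -> i%:R < a.
  by rewrite ltnS => im; rewrite (le_lt_trans _ ma)// ler_nat.
have -> : series (fun j => binom_coef a j *
      (\sum_(i < m.+1) w i *: ffact_poly R i).[j%:R]) =
    (fun N => \sum_(i < m.+1) w i / (i%:R - a) *
      (binom_coef a N * (ffact_poly R i.+1).[N%:R])).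
  apply/funext => N; rewrite /series /=.
  under eq_bigr do rewrite horner_sum mulr_sumr.
  rewrite exchange_big /=; apply: eq_bigr => i _.
  rewrite -mulrA [_^-1 * _]mulrC -sum_binom_coef_ffact; last first.
    by rewrite lt_eqF// ia.
  by rewrite mulr_sumr; apply: eq_bigr => j _; rewrite hornerZ mulrCA.
apply: (@cvg_lincomb0 _ _ (fun i => w i / (i%:R - a))
  (fun i N => binom_coef a N * (ffact_poly R i.+1).[N%:R])) => i /ia.
exact: cvg_binom_coef_ffact.
Qed.

(** * Vanishing of the operators; integer order and polynomials *)

Lemma nabla_pow_vanishesP (R : realType) (a : R) (L : R^nat) :
  nabla_pow_vanishes a L <->
  forall n, series (fun j => binom_coef a j * L (j + n)%N) @ \oo --> (0 : R).
Proof.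
have tE n : nabla_term a L n = (fun j => binom_coef a j * L (j + n)%N).
  by apply/funext => j; rewrite /nabla_term kcoefN.
split=> [[cv lim0] n|cv0].
  by rewrite -tE -(lim0 n); exact: cv.
split=> n; rewrite ?/nabla_pow tE; last exact: cvg_lim.
by apply/cvg_ex; exists 0; exact: cv0.
Qed.

(** The coefficients of [(1 - t)^(m + 1)] vanish beyond [m + 1], so the partial sums are eventually
    constant. *)
Lemma nabla_pow_nat_vanishesP (R : realType) (m : nat) (L : R^nat) :
  nabla_pow_vanishes m.+1%:R L <->
  forall n, \sum_(0 <= j < m.+2) binom_coef (m.+1%:R : R) j * L (j + n)%N = 0.
Proof.
rewrite nabla_pow_vanishesP.
have cv n : series (fun j => binom_coef (m.+1%:R : R) j * L (j + n)%N) @ \oo -->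
    (\sum_(0 <= j < m.+2) binom_coef (m.+1%:R : R) j * L (j + n)%N : R).
  apply: cvg_near_cst; near=> N.
  have mN : (m.+2 <= N)%N by near: N; exact: nbhs_infty_ge.
  rewrite /series /= (@big_cat_nat _ _ _ m.+2)//= [X in _ + X]big1_seq ?addr0// => j.
  rewrite mem_index_iota => /andP[_ /andP[mj _]].
  by rewrite binom_coef_nat_eq0 ?mul0r.
split=> [c0 n|s0 n]; last by rewrite -(s0 n).
exact: (cvg_unique _ (cv n) (c0 n)).
Unshelve. all: by end_near. Qed.

Lemma nabla_pow_poly (R : realType) (a : R) (m : nat) (p : {poly R}) (L : R^nat) :
  m%:R < a -> (size p <= m.+1)%N -> (forall n, L n = p.[n%:R]) ->
  nabla_pow_vanishes a L.
Proof.
move=> ma sp Lp; apply/nabla_pow_vanishesP => n.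
(* The [n]-th term for [p] is the 0-th term for the translate [p(X + n)], which has the same
   size. *)
have -> : (fun j => binom_coef a j * L (j + n)%N) =
    (fun j => binom_coef a j * (p \Po ('X + n%:R%:P)).[j%:R]).
  by apply/funext => j; rewrite Lp horner_comp !hornerE natrD.
apply: (@series_binom_coef_poly _ _ m) => //.
by rewrite size_comp_poly2 ?size_XaddC.
Qed.

(** [L] and its interpolant at [0, ..., m] satisfy the same recurrence of order [m + 1], whose
    leading coefficient is nonzero, so they agree everywhere. *)
Lemma nabla_pow_nat_poly (R : realType) (m : nat) (L : R^nat) :
  nabla_pow_vanishes m.+1%:R L ->
  exists p : {poly R}, (size p <= m.+1)%N /\ forall n : nat, L n = p.[n%:R].
Proof.
move=> /nabla_pow_nat_vanishesP L0.
have [p sp pL] := poly_interpolation_nat m.+1 L.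
exists p; split=> //.
have P0 : nabla_pow_vanishes m.+1%:R (fun n => p.[n%:R]).
  by apply: nabla_pow_poly sp _; rewrite // ltr_nat.
move/nabla_pow_nat_vanishesP : P0 => P0.
have m1 : binom_coef (m.+1%:R : R) m.+1 != 0.
  by apply: binom_coef_neq0 => i im; rewrite eqr_nat ltn_eqF.
elim/ltn_ind => n IH; have [nm|mn] := ltnP n m.+1; first by rewrite pL.
have pE := P0 (n - m.+1)%N; have := L0 (n - m.+1)%N.
rewrite -[RHS]pE !(big_nat_recr m.+1)//= subnKC//.
rewrite (eq_big_nat _ _ (F2 := fun j => binom_coef (m.+1%:R : R) j *
  p.[(j + (n - m.+1))%:R])) => [/addrI/(mulfI m1)//|j /andP[_ jm]].
by rewrite IH//; lia.
Qed.

(** * Multiplying [(1 - t)^a] by polynomials in [t] *)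

(** The quotient of the coefficients [l] and [l - i] is a quotient of two products of [i] factors.
    For [l < i] the left product contains the factor [l - l], which matches the default 0. *)
Lemma binom_coef_sub_ffact (R : realType) (a : R) (i l : nat) :
  binom_coef a l * \prod_(q < i) (l%:R - q%:R) =
  (if (i <= l)%N then binom_coef a (l - i) else 0) *
  \prod_(q < i) (l%:R - (q.+1%:R + a)).
Proof.
elim: i => [|i IH]; first by rewrite !big_ord0 subn0.
rewrite !big_ord_recr /= mulrA IH; have [il|li|->] := ltngtP i l.
- rewrite -(subnSK il) binom_coefS.
  have -> : l%:R = (l - i.+1)%:R + i%:R + 1 :> R by rewrite -natrD natr1; congr _%:R; lia.
  rewrite -!natr1; field.
  by rewrite natr1 pnatr_eq0.
- by rewrite !mul0r.
- by rewrite subrr mulr0 mul0r.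
Qed.

(* The polynomials
   [\prod_(q < i) (x - q) * \prod_(i <= q < M) (x - q - 1 - a)], [i <= M],
   are a basis of the polynomials of degree at most [M], and
   [binom_coef_sub_ffact] identifies the corresponding quotients with the
   shifts of [binom_coef a]. *)
Lemma binom_coef_shift_comb (R : realType) (a : R) (M : nat) (P : {poly R}) :
  (forall i : nat, i%:R != a) -> 0 < a -> (size P <= M.+1)%N ->
  exists w : R^nat, forall l : nat,
    binom_coef a l * (P.[l%:R] / \prod_(q < M) (l%:R - (q.+1%:R + a))) =
    \sum_(i < M.+1) w i * (if (i <= l)%N then binom_coef a (l - i) else 0).
Proof.
move=> ia a0 sP.
pose g i : {poly R} := \prod_(i <= q < M) ('X - (q.+1%:R + a)%:P).
have gE i x : (g i).[x] = \prod_(i <= q < M) (x - (q.+1%:R + a)).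
  by rewrite horner_prod; apply: eq_bigr => q _; rewrite hornerXsubC.
pose e i := ffact_poly R i * g i.
have [i|i k ki|i iM|w ->] := @triangular_poly_basis _ M.+1 e P _ _ _ sP.
- rewrite ltnS => iM; rewrite /e /g (leq_trans (size_polyMleq _ _))//.
  by rewrite size_ffact_poly size_prod_XsubC size_iota; lia.
- by rewrite /e hornerM ffact_poly_nat_eq0 ?mul0r.
- rewrite /e hornerM mulf_neq0 ?ffact_poly_nat_neq0// gE.
  rewrite prodf_seq_neq0; apply/allP => q; rewrite mem_index_iota /= => /andP[iq _].
  rewrite subr_eq0 lt_eqF// ltr_wpDr ?(ltW a0)//.
  by rewrite ltr_nat ltnS.
exists w => l; rewrite horner_sum mulr_suml mulr_sumr.
have c0 q : l%:R - (q.+1%:R + a) != 0.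
  apply/negP => /eqP h; have la : a = l%:R - q.+1%:R by move: h; lra.
  have ql : (q.+1 <= l)%N by rewrite -(ler_nat R) -subr_ge0 -la ltW.
  by have := ia (l - q.+1)%N; rewrite natrB// la eqxx.
apply: eq_bigr => -[i iM] _ /=; rewrite hornerZ -!mulrA mulrCA; congr (_ * _).
rewrite /e hornerM gE horner_prod.
under eq_bigr do rewrite hornerXsubC.
rewrite -(big_mkord xpredT (fun q => l%:R - (q.+1%:R + a))).
rewrite (@big_cat_nat _ _ _ i 0 M)//= big_mkord.
set A := \prod_(_ < i) _; set B := \prod_(_ <= _ < _) _; set C := \prod_(_ < i) _.
have B0 : B != 0 by rewrite prodf_seq_neq0; apply/allP => q _ /=.
have C0 : C != 0 by apply/prodf_neq0 => q _.
have -> : binom_coef a l * (A * B / (C * B)) = binom_coef a l * A / C.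
  by field; rewrite B0 C0.
by rewrite binom_coef_sub_ffact mulfK.
Qed.

(** The weighted coefficients are a finite combination of shifts of [binom_coef a], so the series is
    the same combination of the series for the terms of index [i <= M], each with sum 0. *)
Lemma series_binom_coef_poly_ratio (R : realType) (a : R) (M : nat)
    (P : {poly R}) (L : R^nat) :
  (forall i : nat, i%:R != a) -> 0 < a -> (size P <= M.+1)%N ->
  nabla_pow_vanishes a L ->
  series (fun l => P.[l%:R] / \prod_(q < M) (l%:R - (q.+1%:R + a)) *
    (binom_coef a l * L l)) @ \oo --> (0 : R).
Proof.
move=> ia a0 sP /nabla_pow_vanishesP L0.
have [w wE] := binom_coef_shift_comb ia a0 sP.
have -> : series (fun l => P.[l%:R] / \prod_(q < M) (l%:R - (q.+1%:R + a)) *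
      (binom_coef a l * L l)) =
    (fun N => \sum_(i < M.+1) w i *
      series (fun j => binom_coef a j * L (j + i)%N) (N - i)%N).
  apply/funext => N; rewrite /series /=.
  under eq_bigr do rewrite mulrA [_ / _ * _]mulrC wE mulr_suml.
  rewrite exchange_big /=; apply: eq_bigr => i _.
  under eq_bigr do rewrite -mulrA; rewrite -mulr_sumr; congr (_ * _).
  (* For [N <= i] both sides are empty sums, the truncated [N - i] being 0. *)
  have [Ni|iN] := leqP N i.
    rewrite (eqP Ni) big_geq// big_nat big1// => l /andP[_ lN].
    by rewrite leqNgt (leq_trans lN Ni)/= mul0r.
  rewrite (@big_cat_nat _ _ _ i)//=; last exact: ltnW.
  rewrite big_nat big1 ?add0r; last first.
    by move=> l /andP[_ lN]; rewrite leqNgt lN/= mul0r.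
  rewrite -{1}[i : nat]add0n big_addn; apply: eq_bigr => l _.
  by rewrite leq_addl addnK.
apply: (@cvg_lincomb0 _ _ w (fun i N =>
  series (fun j => binom_coef a j * L (j + i)%N) (N - i)%N)) => i _.
by rewrite (cvg_centern i (series _)); exact: L0.
Qed.

Lemma abel_sum_bound (R : realType) (x g : R^nat) (B k : R) (p : nat) :
  (forall n, `|series x n| <= B) ->
  (forall n, (p <= n)%N -> g n <= g n.+1) ->
  (forall n, (p <= n)%N -> 0 <= g n <= k) ->
  forall n, (p <= n)%N -> `|\sum_(p <= l < n) g l * x l| <= 2 * B * k.
Proof.
move=> xB gS gk.
have B0 : 0 <= B := le_trans (normr_ge0 _) (xB 0%N).
(* Summation by parts: passing to [n + 1] adds [- (g (n+1) - g n) * series x (n+1)], of absolute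
   value at most [B * (g (n+1) - g n)] by monotonicity, and these bounds telescope. *)
have H n : (p <= n)%N ->
    `|\sum_(p <= l < n) g l * x l - g n * series x n| <= B * g n.
  move=> /subnKC <-; elim: (n - p)%N => {n} [|n IH].
    have /andP[g0 _] := gk p (leqnn _).
    by rewrite addn0 big_geq// sub0r normrN normrM mulrC (ger0_norm g0) ler_wpM2r.
  have pn := leq_addr n p; have gS' := gS _ pn.
  rewrite addnS big_nat_recr//=; set N := (p + n)%N in pn gS' IH *.
  have -> : \sum_(p <= l < N) g l * x l + g N * x N - g N.+1 * series x N.+1 =
      \sum_(p <= l < N) g l * x l - g N * series x N -
      (g N.+1 - g N) * series x N.+1.
    by rewrite /series /= big_nat_recr//=; ring.
  apply: (le_trans (ler_normB _ _)).
  have -> : B * g N.+1 = B * g N + (g N.+1 - g N) * B by ring.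
  apply: lerD; first exact: IH.
  by rewrite normrM (@ger0_norm _ (_ - _)) ?subr_ge0// ler_wpM2l ?subr_ge0.
move=> n pn; have /andP[g0 gnk] := gk n pn.
rewrite -[X in `|X|](subrK (g n * series x n)).
apply: (le_trans (ler_normD _ _)).
apply: (@le_trans _ _ (B * g n + g n * B)).
  by rewrite lerD ?H// normrM (ger0_norm g0) ler_wpM2l.
have := ler_wpM2l B0 gnk; lra.
Qed.

(** * The Padé multiplier *)

(** A polynomial in the index [l], not in [t]. *)
Definition pade_poly (R : realType) (m M : nat) : {poly R} :=
  \prod_(q < M) ('X - (m.+2 + q)%:R%:P).

(** The inverse of [pade_ratio] at [l = 0] when [0 < a]: it normalizes the new coefficient of index
    0 to 1. *)
Definition pade_const (R : realType) (a : R) (m M : nat) : R :=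
  \prod_(q < M) ((q.+1%:R + a) / (m.+2 + q)%:R).

Definition pade_ratio (R : realType) (a : R) (m M l : nat) : R :=
  \prod_(q < M) ((l%:R - (m.+2 + q)%:R) / (l%:R - (q.+1%:R + a))).

Lemma pade_ratioE (R : realType) (a : R) (m M l : nat) :
  pade_ratio a m M l =
  (pade_poly R m M).[l%:R] / \prod_(q < M) (l%:R - (q.+1%:R + a)).
Proof.
rewrite /pade_ratio big_split /= -prodfV horner_prod; congr (_ * _).
by apply: eq_bigr => q _; rewrite hornerXsubC.
Qed.

Lemma size_pade_poly (R : realType) (m M : nat) : size (pade_poly R m M) = M.+1.
Proof. by rewrite size_prod_XsubC /index_enum -enumT size_enum_ord. Qed.

Lemma pade_ratio_eq0 (R : realType) (a : R) (m M l : nat) :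
  (m.+2 <= l < m.+2 + M)%N -> pade_ratio a m M l = 0.
Proof.
move=> /andP[ml lM]; have lM' : (l - m.+2 < M)%N by lia.
apply/eqP/prodf_eq0; exists (Ordinal lM') => //=.
by rewrite subnKC// subrr mul0r.
Qed.

Lemma pade_const_ge0 (R : realType) (a : R) (m M : nat) :
  0 < a -> 0 <= pade_const a m M.
Proof.
by move=> a0; apply: prodr_ge0 => q _; rewrite divr_ge0// addr_ge0// ltW.
Qed.

Lemma cvg_pade_const (R : realType) (a : R) (m : nat) :
  0 < a -> a < m.+1%:R -> pade_const a m M @[M --> \oo] --> (0 : R).
Proof.
(* The factor of index [n] is [1 - (m + 1 - a) / (n + m + 2)]. *)
move=> a0 am; apply: (@cvg0_of_ratio _ (m.+1%:R - a) m.+1).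
- by rewrite subr_gt0.
- by rewrite -[m.+2]addn1 natrD; lra.
move=> n; rewrite /pade_const big_ord_recr /= mulrC; congr (_ * _).
have -> : (m.+2 + n = (n + m.+1).+1)%N by lia.
by rewrite -!natr1 natrD -natr1; field; rewrite natr1 -natrD !natr1 pnatr_eq0.
Qed.

Lemma nat_neq_between (R : realType) (a : R) (m i : nat) :
  m%:R < a -> a < m.+1%:R -> i%:R != a.
Proof.
by move=> ma am; apply/eqP => ia; move: ma am; rewrite -ia !ltr_nat; lia.
Qed.

(** Each factor equals [1 - (m + 1 - a) / (l - q - 1 - a)] with positive denominator, hence
    increases with [l]; its numerator [l - m - 2 - q] is nonnegative. *)
Lemma pade_ratio_bounds (R : realType) (a : R) (m M l : nat) :
  a < m.+1%:R -> (m.+2 + M <= l)%N ->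
  0 <= pade_ratio a m M l <= 1 /\ pade_ratio a m M l <= pade_ratio a m M l.+1.
Proof.
move=> am Ml; pose f (q l : nat) := (l%:R - (m.+2 + q)%:R) / (l%:R - (q.+1%:R + a)).
have f_bounds q : (q < M)%N -> 0 <= f q l <= 1 /\ f q l <= f q l.+1.
  move=> qM; rewrite /f.
  have h1 : m.+1%:R + q.+1%:R + 1 <= l%:R :> R.
    by rewrite -natrD natr1 ler_nat; lia.
  have h2 : (m.+2 + q)%:R = m.+1%:R + q.+1%:R :> R by rewrite -natrD; congr _%:R; lia.
  have h3 : 0 < l%:R - (q.+1%:R + a).
    by rewrite subr_gt0; lra.
  have h4 : 0 < l.+1%:R - (q.+1%:R + a) by rewrite -natr1; lra.
  split.
    apply/andP; split; last by rewrite ler_pdivrMr// mul1r h2; lra.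
    by rewrite divr_ge0 ?(ltW h3)// subr_ge0 ler_nat; lia.
  rewrite ler_pdivrMr// mulrAC ler_pdivlMr// -[l.+1%:R]natr1.
  by nra.
split; first (apply/andP; split).
- by apply: prodr_ge0 => -[q qM] _; have [/andP[]] := f_bounds _ qM.
- by apply: prodr_ile1 => -[q qM] _; have [] := f_bounds _ qM.
- by apply: ler_prod => -[q qM] _; have [/andP[f0 _] f1] := f_bounds _ qM; exact/andP.
Qed.

(** Raising [l] by 1 shifts both products by one index, so only the end factors survive. The
    identity is cross-multiplied since [l - m - 1 - M] can vanish. *)
Lemma pade_ratioS (R : realType) (a : R) (m M l : nat) :
  0 < a -> (forall i : nat, i%:R != a) ->
  pade_ratio a m M l.+1 * ((l%:R - a) * (l%:R - m.+1%:R - M%:R)) =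
  pade_ratio a m M l * ((l%:R - m.+1%:R) * (l%:R - a - M%:R)).
Proof.
(* A zero would give [a = q - k], a natural number because [a > 0]. *)
move=> a0 ia; have nz (q k : nat) : q%:R - a - k%:R != 0.
  apply/negP => /eqP h; have qa : a = q%:R - k%:R by move: h; lra.
  have kq : (k <= q)%N by rewrite -(ler_nat R) -subr_ge0 -qa ltW.
  by have := ia (q - k)%N; rewrite natrB// qa eqxx.
elim: M => [|M IH]; first by rewrite /pade_ratio !big_ord0 !subr0 [_ * (l%:R - a)]mulrC.
rewrite /pade_ratio !big_ord_recr /= -/(pade_ratio a m M l) -/(pade_ratio a m M l.+1).
have n1 := nz l M; have n2 := nz l M.+1.
have e1 : (m.+2 + M)%:R = m.+1%:R + M%:R + 1 :> R.
  by rewrite -!natrD natr1; congr _%:R; lia.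
rewrite e1 -[l.+1%:R]natr1 -[M.+1%:R]natr1 in n2 *.
set y := pade_ratio a m M l in IH *; set z := pade_ratio a m M l.+1 in IH *.
have -> : z * ((l%:R + 1 - (m.+1%:R + M%:R + 1)) / (l%:R + 1 - (M%:R + 1 + a))) *
    ((l%:R - a) * (l%:R - m.+1%:R - (M%:R + 1))) =
  z * ((l%:R - a) * (l%:R - m.+1%:R - M%:R)) *
  ((l%:R - m.+1%:R - (M%:R + 1)) / (l%:R - a - M%:R)).
  by field.
rewrite IH; field.
by rewrite n1 andbT; apply: contra n2 => /eqP h; apply/eqP; lra.
Qed.

Lemma cvg_pade_coef (R : realType) (a : R) (m l : nat) :
  0 < a -> m%:R < a -> a < m.+1%:R -> (l <= m.+1)%N ->
  pade_const a m M * pade_ratio a m M l * binom_coef a l @[M --> \oo] -->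
  binom_coef (m.+1%:R : R) l.
Proof.
move=> a0 ma am; have ia i := nat_neq_between i ma am.
elim: l => [_|l IH lm].
  rewrite !binom_coef0; apply: cvg_near_cst; near=> M; rewrite mulr1.
  rewrite /pade_const /pade_ratio -big_split /= big1// => q _.
  rewrite !sub0r invrN mulrNN mulrA divfK ?pnatr_eq0// divff//.
  by rewrite lt0r_neq0// addr_gt0.
rewrite [X in _ --> X]binom_coefS.
(* By [pade_ratioS] the quotient of consecutive coefficients is that of order [m + 1] times
   [1 - (m + 1 - a) / (M + m + 1 - l)], which tends to 1. *)
have -> : (fun M => pade_const a m M * pade_ratio a m M l.+1 * binom_coef a l.+1) =
  (fun M => pade_const a m M * pade_ratio a m M l * binom_coef a l *
     ((l%:R - m.+1%:R) / l.+1%:R * (1 - (m.+1%:R - a) * harmonic (M + (m - l))%N))).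
  apply/funext => M; rewrite binom_coefS.
  have hl : l%:R - a != 0 by rewrite subr_eq0 ia.
  have h2 : (M + (m - l)).+1%:R = M%:R + m.+1%:R - l%:R :> R.
    by rewrite -natrD -natrB; [congr _%:R; lia | lia].
  have h3 : M%:R + m.+1%:R - l%:R != 0 :> R by rewrite -h2 pnatr_eq0.
  rewrite /harmonic /= h2.
  have -> : pade_ratio a m M l.+1 = pade_ratio a m M l *
      ((l%:R - m.+1%:R) * (l%:R - a - M%:R)) / ((l%:R - a) * (l%:R - m.+1%:R - M%:R)).
    rewrite -pade_ratioS// mulfK// mulf_neq0//.
    by apply: contra h3 => /eqP h; apply/eqP; lra.
  rewrite -[l.+1%:R]natr1; field.
  rewrite hl natr1 pnatr_eq0 andbT /=.
  by apply/andP; split; apply: contra h3 => /eqP h; apply/eqP; lra.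
apply: cvgM; first by apply: IH; exact: ltnW.
rewrite -[X in _ --> X]mulr1; apply: cvgM; first exact: cvg_cst.
rewrite -[X in _ --> X](subr0 1); apply: cvgB; first exact: cvg_cst.
rewrite -[X in _ --> X](mulr0 (m.+1%:R - a)); apply: cvgM; first exact: cvg_cst.
by rewrite (cvg_shiftn (m - l) (@harmonic R : R^nat)); exact: cvg_harmonic.
Unshelve. all: by end_near. Qed.

(** * From order [a] to order [m + 1] *)

Lemma nabla_pow_ceil_term0 (R : realType) (a : R) (m : nat) (L : R^nat) :
  0 < a -> m%:R < a -> a < m.+1%:R -> nabla_pow_vanishes a L ->
  \sum_(l < m.+2) binom_coef (m.+1%:R : R) l * L l = 0.
Proof.
move=> a0 ma am La; have ia i := nat_neq_between i ma am.
pose x l := binom_coef a l * L l.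
have x0 : series x @ \oo --> (0 : R).
  have /nabla_pow_vanishesP/(_ 0%N) := La.
  by under [X in series X]eq_fun do rewrite addn0.
have [B xB] : exists B : R, forall n, `|series x n| <= B.
  have xc : cvgn (series x) by apply/cvg_ex; exists 0.
  have [B [_ xB]] := cvg_seq_bounded xc.
  by exists (B + 1) => n; apply: xB => //; rewrite ltrDl.
pose F M := \sum_(l < m.+2) pade_const a m M * pade_ratio a m M l * x l.
have F_le M : `|F M| <= 2 * B * pade_const a m M.
  pose g l := pade_const a m M * pade_ratio a m M l.
  have k0 := pade_const_ge0 m M a0.
  have sg0 : series (fun l => g l * x l) @ \oo --> (0 : R).
    have -> : series (fun l => g l * x l) = (fun N => pade_const a m M *
        series (fun l => (pade_poly R m M).[l%:R] /
          \prod_(q < M) (l%:R - (q.+1%:R + a)) * x l) N).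
      apply/funext => N; rewrite /series /= mulr_sumr; apply: eq_bigr => l _.
      by rewrite -pade_ratioE /g -!mulrA.
    rewrite -[X in _ --> X](mulr0 (pade_const a m M)).
    apply: cvgM; first exact: cvg_cst.
    by apply: series_binom_coef_poly_ratio => //; rewrite size_pade_poly.
  (* The full series has sum 0 and its terms between [m + 2] and [m + 1 + M] vanish, so this
     difference is, up to sign, the tail, which Abel summation bounds uniformly in [N]. *)
  have lim1 : `|F M - series (fun l => g l * x l) N| @[N --> \oo] --> `|F M|.
    rewrite -{2}[F M]subr0.
    by apply: cvg_norm; apply: cvgB => //; exact: cvg_cst.
  apply: (ler_cvg_to lim1 (cvg_cst _)).
  near=> N; have pN : (m.+2 + M <= N)%N by near: N; exact: nbhs_infty_ge.
  have -> : series (fun l => g l * x l) N =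
      F M + \sum_(m.+2 + M <= l < N) g l * x l.
    rewrite /series /= (big_cat_nat (n := m.+2 + M))//=; congr (_ + _).
    rewrite (big_cat_nat (n := m.+2))//=; last exact: leq_addr.
    rewrite big_mkord [X in _ + X]big_nat [X in _ + X]big1 ?addr0// => l.
    by move=> /pade_ratio_eq0 g0; rewrite /g g0 mulr0 mul0r.
  rewrite opprD addrA subrr sub0r normrN.
  apply: (abel_sum_bound xB _ _ pN) => l /(pade_ratio_bounds am)[/andP[g0 g1] gS].
    by rewrite ler_wpM2l.
  by rewrite mulr_ge0//= ler_piMr.
have F_lim : F M @[M --> \oo] --> \sum_(l < m.+2) binom_coef (m.+1%:R : R) l * L l.
  apply: (@cvg_sum_ord _ _ (fun l M => pade_const a m M * pade_ratio a m M l * x l)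
    (fun l => binom_coef (m.+1%:R : R) l * L l)) => l lm.
  under eq_fun do rewrite mulrA.
  by apply: cvgM; [exact: cvg_pade_coef | exact: cvg_cst].
apply/eqP; rewrite -normr_le0.
have b0 : 2 * B * pade_const a m M @[M --> \oo] --> (0 : R).
  rewrite -[X in _ --> X](mulr0 (2 * B)); apply: cvgM; first exact: cvg_cst.
  exact: cvg_pade_const.
apply: (ler_cvg_to (cvg_norm F_lim) b0).
by near=> M; exact: F_le.
Unshelve. all: by end_near. Qed.

Lemma nabla_pow_ceil_vanishes (R : realType) (a : R) (m : nat) (L : R^nat) :
  0 < a -> m%:R < a -> a < m.+1%:R ->
  nabla_pow_vanishes a L -> nabla_pow_vanishes m.+1%:R L.
Proof.
move=> a0 ma am /nabla_pow_vanishesP La; apply/nabla_pow_nat_vanishesP => n.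
(* The hypothesis passes to every translate of [L], so the term of index 0 suffices. *)
rewrite big_mkord; apply: (@nabla_pow_ceil_term0 _ a _ (fun l => L (l + n)%N)) => //.
apply/nabla_pow_vanishesP => k.
by under [X in series X]eq_fun do rewrite -addnA; exact: La.
Qed.

Theorem theorem4p6 (R : realType) (a : R) (m : nat) (L : R^nat)
    (a_gt0 : 0 < a) (ma : m%:R < a) (am : a <= m.+1%:R) :
  (nabla_pow_vanishes a L <-> nabla_pow_vanishes m.+1%:R L) /\
  (nabla_pow_vanishes m.+1%:R L <->
   exists p : {poly R}, (size p <= m.+1)%N /\ forall n : nat, L n = p.[n%:R]).
Proof.
split; split=> [La|].
(* For [a = m + 1] the two statements coincide; the Padé argument covers [a < m + 1], where
   [pade_const] tends to 0. *)
- have [<-//|a_neq] := eqVneq a m.+1%:R.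
  by apply: nabla_pow_ceil_vanishes La => //; rewrite lt_neqAle a_neq.
- by move=> /nabla_pow_nat_poly[p [sp pL]]; exact: nabla_pow_poly ma sp pL.
- exact: nabla_pow_nat_poly.
- by move=> [p [sp pL]]; apply: nabla_pow_poly sp pL; rewrite ltr_nat.
Qed.
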